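(* There is a universal constant $c$ (independent of all problem parameters) such that the following holds. Consider the caching problem with files $\mathcal{N}=\{1,\dots,N\}$ having popularities $p_1\ge p_2\ge\dots\ge p_N>0$, $K$ users, and normalized cache size $M\ge 0$. Let $\mathcal{N}_1,\dots,\mathcal{N}_L$ be the maximal partition of $\mathcal{N}$ to within popularity factor two, let $N_\ell=|\mathcal{N}_\ell|$, and let $\mathsf{K}_\ell$ be the random number of users whose demand lies in $\mathcal{N}_\ell$. Then \[ R^\star(M,\mathcal{N},K)\;\ge\;\frac{1}{cL}\sum_{\ell=1}^L \mathbb{E}\bigl(R(M,N_\ell,\mathsf{K}_\ell)\bigr). \]
   Context: Caching problem: a server holds $N$ files, each of $F$ bits, connected through a shared error-free link to $K$ users, each with a cache of $MF$ bits. In the placement phase (before demands are known), each user stores an arbitrary function of the files of at most $MF$ bits. In the delivery phase each user $k$ independently requests file $\mathsf{d}_k$ with $\Pr(\mathsf{d}_k=n)=p_n$; the server sends a message over the shared link from which, together with its cache, each user must reconstruct its requested file. The rate for a demand vector is the message length divided by $F$; $R^\star(M,\mathcal{N},K)$ denotes the infimum of expected rates (expectation over demands) achievable with vanishing error probability for all sufficiently large $F$, over all schemes. Maximal partition to within popularity factor two: $\mathcal{N}_1=\{1,\dots,N_1\}$ where $N_1$ is the largest index with $p_{N_1}\ge p_1/2$; recursively, if $n$ is the smallest file not yet assigned, the next group is $\{n,\dots,n+N_\ell-1\}$ with $p_{n+N_\ell-1}\ge p_n/2$ and $p_{n+N_\ell}<p_n/2$ (or $n+N_\ell-1=N$); $L$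 is the number of groups. $\mathsf{K}_\ell$ is Binomial$(K,\sum_{n\in\mathcal{N}_\ell}p_n)$. The function $R$ is defined for real $M\ge0$ and integers $N\ge1,K\ge0$ by $R(M,N,K)=(1-M/N)\min\{\tfrac{N}{M}(1-(1-M/N)^K),N\}$ for $M\in(0,N]$, $R(0,N,K)=\min\{N,K\}$, and $R(M,N,K)=0$ for $M>N$. *)

(* Defs.v *)
From HB Require Import structures.
From mathcomp Require Import all_boot all_order all_algebra.
From mathcomp Require Import boolp classical_sets reals.
Set Implicit Arguments. Unset Strict Implicit. Unset Printing Implicit Defensive.
Import Order.TTheory GRing.Theory Num.Theory.
Local Open Scope ring_scope.

Definition files_t (N F : nat) := {ffun 'I_N -> {ffun 'I_F -> bool}}.
Definition demand_t (N K : nat) := {ffun 'I_K -> 'I_N}.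

(* Probability of demand vector d: users request independently, Pr(d_k = n) = p n. *)
Definition dprob (R : nzRingType) (N K : nat) (p : nat -> R) (d : demand_t N K) : R :=
  \prod_(k < K) p (d k).

(* At blocklength F there is a scheme with cache size at most M F bits,
   error probability (for every demand, over uniformly distributed files)
   at most eps, and expected rate at most r + eps.  Cache contents are
   m-bit strings (encoded as 'I_(2^m)) with m <= M F; for demand d the
   message has len d bits. *)
Definition scheme_exists (R : realType) (N K F : nat) (M : R) (p : nat -> R)
  (eps r : R) : Prop :=
  exists (m : nat) (cache : 'I_K -> files_t N F -> 'I_(2 ^ m))
    (len : demand_t N K -> nat)
    (enc : forall d : demand_t N K, files_t N F -> 'I_(2 ^ len d))
    (dec : forall d : demand_t N K, 'I_K -> 'I_(2 ^ len d) -> 'I_(2 ^ m) ->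
             {ffun 'I_F -> bool}),
    [/\ m%:R <= M * F%:R,
        (forall d : demand_t N K,
           #|[set w : files_t N F |
               [exists k : 'I_K, dec d k (enc d w) (cache k w) != w (d k)]]|%:R
           <= eps * #|{: files_t N F}|%:R) &
        \sum_(d : demand_t N K) dprob p d * ((len d)%:R / F%:R) <= r + eps].

Definition achievable (R : realType) (N K : nat) (M : R) (p : nat -> R) (r : R) : Prop :=
  forall eps : R, 0 < eps ->
    exists F0 : nat, forall F : nat, (F0 <= F)%N -> (0 < F)%N ->
      scheme_exists N K F M p eps r.

Definition Rstar (R : realType) (N K : nat) (M : R) (p : nat -> R) : R :=
  inf [set r : R | achievable N K M p r].

Definition Rfn (R : realFieldType) (M : R) (N K : nat) : R :=
  if M == 0 then (minn N K)%:R
  else if (0 < M) && (M <= N%:R) then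
    (1 - M / N%:R) * Num.min (N%:R / M * (1 - (1 - M / N%:R) ^+ K)) N%:R
  else 0.

(* Maximal partition to within popularity factor two, with 0-based file
   indices 0..N-1: group l (l < L) is {b l, ..., b (l+1) - 1}. *)
Definition is_max_partition (R : realFieldType) (N : nat) (p : nat -> R)
  (L : nat) (b : nat -> nat) : Prop :=
  [/\ b 0%N = 0%N, b L = N &
      forall l : nat, (l < L)%N ->
        [/\ (b l < b l.+1)%N,
            p (b l) / 2 <= p (b l.+1).-1 &
            b l.+1 = N \/ p (b l.+1) < p (b l) / 2]].

Definition users_in (N K : nat) (b : nat -> nat) (l : nat) (d : demand_t N K) : nat :=
  #|[set k : 'I_K | (b l <= d k < b l.+1)%N]|.

(* Main.v *)
(** It suffices to bound the rate from below separately for each popularity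
    group [G], of size [n], and to average over the groups.  Fix [G] and
    condition on the set [S] of users whose demand lies in [G].  The caches of
    the users in [A] and the messages for demand vectors [D j] determine all
    files requested by [A], hence the cut-set inequality
    [#|U| <= #|A| * M + \sum_j len (D j) / F + 1 / F].
    - If [M > n / 4], use one user of [S] and let its demand run over [G]; since
      every file of [G] has conditional popularity at least [1 / (2 n)], the
      conditional expected rate is at least [(1 - M / n) / 2].
    - If [M <= n / 4], draw [t ~ n / s] independent demand vectors conditioned on
      [S] and use [s] users of [S], with [s] maximal such that
      [s <= min (n, #|S|)] and [4 s M <= n].  The [s t >= n] requests hit at least
      [n / 3] files on average, which exceeds the cache contents by [n / 12], so
      the conditional expected rate is at least of order [s].
    In both cases this is a constant fraction of [R(M, n, #|S|)], pointwise in [S]. *)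
Require Import Defs.
From HB Require Import structures.
From mathcomp Require Import all_boot all_order all_algebra.
From mathcomp Require Import boolp classical_sets reals.
From mathcomp Require Import ring lra zify.
Import Order.TTheory GRing.Theory Num.Theory.
Local Open Scope ring_scope.
Set Implicit Arguments. Unset Strict Implicit.

(** * Cut-set inequality by counting *)

Lemma card_files (N F : nat) : #|{: files_t N F}| = (2 ^ (F * N))%N.
Proof. by rewrite !card_ffun card_bool !card_ord -expnM. Qed.

Lemma foldr_muln_expn (T : Type) (a : nat) (f : T -> nat) (s : seq T) :
  foldr muln 1%N [seq (a ^ f x)%N | x <- s] = (a ^ \sum_(x <- s) f x)%N.
Proof. by elim: s => [|x s IHs] /=; rewrite ?big_nil // big_cons IHs expnD. Qed.

(** A good file tuple is determined by the caches of [A], the messages for all [D j] and the files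
    outside [U], since these caches and messages decode every file of [U]. Comparing cardinalities
    gives the bound; the final [1] is the bit lost because [good] may be only half of all tuples. *)
Lemma cutset_counting (N K F m : nat) (J : finType) (A : {set 'I_K})
    (U : {set 'I_N}) (D : J -> demand_t N K)
    (cache : 'I_K -> files_t N F -> 'I_(2 ^ m)) (len : J -> nat)
    (enc : forall j, files_t N F -> 'I_(2 ^ len j))
    (dec : forall j, 'I_K -> 'I_(2 ^ len j) -> 'I_(2 ^ m) -> {ffun 'I_F -> bool})
    (good : {set files_t N F}) :
  (forall i, i \in U -> exists j, exists2 k, k \in A & D j k = i) ->
  (forall w j k, w \in good -> dec j k (enc j w) (cache k w) = w (D j k)) ->
  (#|{: files_t N F}| <= 2 * #|good|)%N ->
  (#|U| * F <= #|A| * m + \sum_j len j + 1)%N.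
Proof.
move=> covU decP leg.
pose T := (({ffun {k : 'I_K | k \in A} -> 'I_(2 ^ m)} *
            {dffun forall j : J, 'I_(2 ^ len j)}) *
           {ffun {i : 'I_N | i \in ~: U} -> {ffun 'I_F -> bool}})%type.
pose f (w : files_t N F) : T :=
  ([ffun k => cache (val k) w], [ffun j => enc j w], [ffun i => w (val i)]).
have /leq_card_in : {in good &, injective f}.
  move=> w w' gw gw' [] /ffunP eqc /ffunP eqe /ffunP eqw.
  apply/ffunP => i; have [Ui|nUi] := boolP (i \in U); last first.
    have Ci : i \in ~: U by rewrite inE.
    by have := eqw (exist _ i Ci); rewrite !ffunE.
  have [j [k Ak <-]] := covU i Ui; rewrite -!decP //.
  have := eqc (exist _ k Ak); rewrite !ffunE /= => ->.
  by have := eqe j; rewrite !ffunE => ->.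
have -> : #|{: T}| = (2 ^ (m * #|A| + \sum_j len j + F * (N - #|U|)))%N.
  rewrite !card_prod !card_ffun !card_sig card_dep_ffun.
  have -> : [seq #|'I_(2 ^ len x)| | x : J] = [seq (2 ^ len x)%N | x <- enum J].
    by apply: eq_map => j; rewrite card_ord.
  rewrite foldr_muln_expn big_enum card_bool !card_ord -!expnM -!expnD.
  have -> : #|[pred x | x \in ~: U]| = (N - #|U|)%N.
    by rewrite -[RHS](_ : #|~: U| = _) // cardsCs finset.setCK card_ord.
  by [].
move=> le1.
have := leq_trans leg (leq_mul (leqnn 2) le1).
rewrite card_files -expnS leq_exp2l //.
have : (#|U| <= N)%N by rewrite -[X in (_ <= X)%N]card_ord max_card.
nia.
Qed.

(* The slack [del] is [1 / F]: the decoding errors cost at most one bit. *)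
Definition cutset_bound {R : realType} {N K : nat} (M : R) (T : nat) (del : R)
    (ell : demand_t N K -> R) : Prop :=
  forall (J : finType) (D : J -> demand_t N K) (A : {set 'I_K}) (U : {set 'I_N}),
    (#|J| <= T)%N ->
    (forall i, i \in U -> exists j, exists2 k, k \in A & D j k = i) ->
    #|U|%:R <= #|A|%:R * M + \sum_j ell (D j) + del.

(** Union bound: at most [T] demand vectors fail together on a fraction [T * eps <= 1/2] of the file
    tuples, so at least half are decoded correctly for all of them. Here [ell] is the message length
    per file bit. *)
Lemma scheme_cutset_bound (R : realType) (N K F T : nat) (M : R) (p : nat -> R)
    (eps r : R) :
  (0 < F)%N -> 0 < eps -> T%:R * eps <= 2^-1 ->
  scheme_exists N K F M p eps r ->
  exists ell : demand_t N K -> R,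
    [/\ forall d, 0 <= ell d, cutset_bound M T F%:R^-1 ell &
        \sum_d dprob p d * ell d <= r + eps].
Proof.
move=> F0 eps0 Teps [m [cache [len [enc [dec [mM err rate]]]]]].
have F0R : 0 < F%:R :> R by rewrite ltr0n.
exists (fun d => (len d)%:R / F%:R); split=> //.
  by move=> d; rewrite divr_ge0 ?ler0n.
move=> J D A U JT covU.
pose bad d := [set w : files_t N F |
  [exists k : 'I_K, dec d k (enc d w) (cache k w) != w (d k)]].
pose good := ~: \bigcup_j bad (D j).
have : (#|U| * F <= #|A| * m + \sum_j len (D j) + 1)%N.
  apply: (@cutset_counting _ _ _ _ _ _ _ D cache (fun j => len (D j))
           (fun j => enc (D j)) (fun j => dec (D j)) good) => //.
    move=> w j k; rewrite inE => /bigcupP nb; apply/eqP; apply/negPn/negP => ne.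
    by apply: nb; exists j => //; rewrite inE; apply/existsP; exists k.
  have : #|\bigcup_j bad (D j)|%:R <= 2^-1 * #|{: files_t N F}|%:R :> R.
    apply: (@le_trans _ _ (\sum_j #|bad (D j)|%:R)).
      rewrite -natr_sum ler_nat.
      elim/big_ind2: _ => [|x y s t xy st|//]; first by rewrite finset.cards0.
      by apply: leq_trans (leq_card_setU _ _) (leq_add xy st).
    apply: (@le_trans _ _ (\sum_(j : J) eps * #|{: files_t N F}|%:R)).
      by apply: ler_sum => j _; apply: err.
    rewrite sumr_const -[X in X <= _]mulr_natl mulrA; apply: ler_wpM2r; rewrite ?ler0n //.
    by apply: le_trans Teps; rewrite ler_pM2r // ler_nat.
  have := cardsC (\bigcup_j bad (D j)); rewrite -/good => <-.
  rewrite natrD -(ler_nat R) natrM natrD; lra.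
rewrite -(ler_nat R) !natrD !natrM natr_sum => le.
have -> : \sum_j (len (D j))%:R / F%:R = (\sum_j (len (D j))%:R) / F%:R :> R.
  by rewrite mulr_suml.
have mA : #|A|%:R * m%:R <= #|A|%:R * (M * F%:R) by rewrite ler_wpM2l ?ler0n.
rewrite -(ler_pM2r F0R) !mulrDl -!mulrA !mulVf ?gt_eqF // mulr1; lra.
Qed.

(** * The product law of the demands *)

Lemma sum_dprob_family (R : comNzRingType) (N K : nat) (p : nat -> R)
    (Q : 'I_K -> pred 'I_N) :
  \sum_(d : demand_t N K | [forall k, Q k (d k)]) dprob p d =
  \prod_k \sum_(i < N | Q k i) p i.
Proof.
rewrite bigA_distr_big_dep; apply: eq_bigl => d.
by apply/forallP/familyP.
Qed.

Lemma sum_dprob (R : comNzRingType) (N K : nat) (p : nat -> R) :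
  \sum_(n < N) p n = 1 -> \sum_(d : demand_t N K) dprob p d = 1.
Proof.
by move=> p1; rewrite -(bigA_distr_bigA (fun (_ : 'I_K) (i : 'I_N) => p i)) big1.
Qed.

(** * Elementary inequalities and upper bounds on [Rfn] *)

(** Keeps the probability of missing a file in [m] trials away from 1 once [m * y] is bounded below.
    The induction rests on [(1 - y) * (1 + (m + 1) * y) <= 1 + m * y]. *)
Lemma expr_1sub_le (R : realFieldType) (y : R) (m : nat) :
  0 <= y <= 1 -> (1 - y) ^+ m * (1 + m%:R * y) <= 1.
Proof.
move=> /andP[y0 y1]; elim: m => [|m IHm]; first by rewrite expr0 mul0r addr0 mulr1.
apply: le_trans IHm; rewrite exprSr -mulrA; apply: ler_wpM2l.
  by apply: exprn_ge0; lra.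
rewrite -natr1; have : 0 <= m%:R :> R by []. nra.
Qed.

Lemma Bernoulli_1sub (R : realFieldType) (a : R) (k : nat) :
  0 <= a <= 1 -> 1 - a ^+ k <= k%:R * (1 - a).
Proof.
move=> /andP[a0 a1]; elim: k => [|k IHk]; first by rewrite expr0 subrr mul0r.
rewrite exprS -natr1.
have : 0 <= a ^+ k <= 1 by rewrite exprn_ge0 // exprn_ile1.
move: (a ^+ k) IHk => x IHk /andP[x0 x1]; nra.
Qed.

Lemma Rfn_le_min (R : realFieldType) (M : R) (n k : nat) :
  (0 < n)%N -> Rfn M n k <= (minn n k)%:R.
Proof.
rewrite -(ltr0n R) => n0; rewrite /Rfn; case: eqP => [//|_].
case: ifP => [/andP[M0 Mn]|_]; last exact: ler0n.
have a01 : 0 <= 1 - M / n%:R <= 1.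
  by rewrite subr_ge0 ler_pdivrMr // mul1r Mn gerBl divr_ge0 // ltW.
have [a0 a1] := andP a01.
have ak : 0 <= n%:R / M * (1 - (1 - M / n%:R) ^+ k) <= k%:R.
  apply/andP; split.
    by rewrite mulr_ge0 ?subr_ge0 ?exprn_ile1 // divr_ge0 // ltW.
  have := Bernoulli_1sub k a01; rewrite opprB addrCA subrr addr0 => le.
  rewrite mulrAC ler_pdivrMr // mulrC -ler_pdivlMr // -mulrA; exact: le.
case/andP: ak => ak0 ak.
apply: (@le_trans _ _ (Num.min (n%:R / M * (1 - (1 - M / n%:R) ^+ k)) n%:R)).
  by apply: ler_piMl => //; rewrite le_min ak0 ltW.
by rewrite /minn; case: ltnP => _; rewrite ge_min ?ak ?lexx ?orbT.
Qed.

Lemma Rfn_le_div (R : realFieldType) (M : R) (n k : nat) :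
  0 < M -> (0 < n)%N -> M <= n%:R -> Rfn M n k <= (1 - M / n%:R) * (n%:R / M).
Proof.
rewrite -(ltr0n R) => M0 n0 Mn; rewrite /Rfn gt_eqF // M0 Mn /=.
have a0 : 0 <= 1 - M / n%:R by rewrite subr_ge0 ler_pdivrMr // mul1r.
apply: ler_wpM2l => //; rewrite ge_min; apply/orP; left.
apply: ler_piMr; first by rewrite divr_ge0 // ltW.
by rewrite gerBl exprn_ge0.
Qed.

Lemma Rfn_gt_eq0 (R : realFieldType) (M : R) (n k : nat) :
  n%:R < M -> Rfn M n k = 0.
Proof.
move=> nM; rewrite /Rfn gt_eqF; last exact: le_lt_trans nM.
by rewrite [M <= _]leNgt nM andbF.
Qed.

Lemma subset_of_card (T : finType) (S : {set T}) (s : nat) :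
  (s <= #|S|)%N -> exists2 A : {set T}, A \subset S & #|A| = s.
Proof.
move=> sS; exists [set x in take s (enum S)]%SET.
  by apply/fintype.subsetP => x; rewrite inE => /mem_take; rewrite mem_enum.
rewrite cardsE; have /card_uniqP -> : uniq (take s (enum S)).
  by rewrite take_uniq // enum_uniq.
by rewrite size_takel // -cardE.
Qed.

(** * Lower bound on the rate from one popularity group *)

Section Group.
Context {R : realType} {N K : nat}.
Variables (M : R) (p : nat -> R) (G : {set 'I_N}) (ell : demand_t N K -> R).
Variables (T : nat) (del : R).
Hypothesis M0 : 0 <= M.
Hypothesis p_gt0 : forall i : 'I_N, 0 < p i.
Hypothesis ell_ge0 : forall d, 0 <= ell d.
Hypothesis del0 : 0 <= del.
Hypothesis cutset : cutset_bound M T del ell.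
(** The cut-sets below combine either [n] or at most [2 * n] demand vectors. *)
Hypothesis NT : (2 * N <= T)%N.

Local Notation n := #|G|.
Local Notation P := (\sum_(i in G) p i).
Hypothesis n0 : (0 < n)%N.
(** Given that a request falls in [G], each file of [G] has probability at least [1 / (2 n)]. *)
Hypothesis near_uniform : forall i, i \in G -> P <= 2 * n%:R * p i.

Definition group_users (d : demand_t N K) : {set 'I_K} := [set k | d k \in G].

Definition redirect (k0 : 'I_K) (d : demand_t N K) (i : 'I_N) : demand_t N K :=
  [ffun k => if k == k0 then i else d k].

Lemma dprob_ge0 (d : demand_t N K) : 0 <= dprob p d.
Proof. by apply: prodr_ge0 => k _; apply: ltW. Qed.

Lemma group_prob_gt0 : 0 < P.
Proof.
have [i Gi] : exists i, i \in G by apply/set0Pn; rewrite -card_gt0.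
rewrite (bigD1 i) //=; apply: ltr_wpDr => //.
by apply: sumr_ge0 => j _; apply: ltW.
Qed.

Lemma group_prob_le (i : 'I_N) : i \in G -> P / (2 * n%:R) <= p i.
Proof.
move=> Gi; rewrite ler_pdivrMr; first by rewrite mulrC near_uniform.
by rewrite mulr_gt0 ?ltr0n.
Qed.

Lemma group_users_redirect k0 d i :
  k0 \in group_users d -> i \in G -> group_users (redirect k0 d i) = group_users d.
Proof.
move=> dk Gi; apply/setP => k; rewrite !inE !ffunE.
by case: eqP => // ->; rewrite Gi; move: dk; rewrite inE.
Qed.

Lemma dprob_redirect k0 d i :
  dprob p (redirect k0 d i) * p (d k0) = dprob p d * p i.
Proof.
rewrite /dprob (bigD1 k0) //= [in RHS](bigD1 k0) //= ffunE eqxx.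
rewrite (eq_bigr (fun k => p (d k))); first by ring.
by move=> k /negPf nk; rewrite ffunE nk.
Qed.

(* The demand of [k0] and an independent copy of it are exchangeable. *)
Lemma resample_user (S : {set 'I_K}) (k0 : 'I_K) : k0 \in S ->
  \sum_(d | group_users d == S) dprob p d * \sum_(i in G) p i * ell (redirect k0 d i)
  = P * \sum_(d | group_users d == S) dprob p d * ell d.
Proof.
move=> Sk.
(* The involution swapping the demand of [k0] with the independent file; it preserves the product
   weight. *)
pose h (x : demand_t N K * 'I_N) := (redirect k0 x.1 x.2, x.1 k0).
have hK : cancel h h.
  case=> d i; rewrite /h /=; congr pair; last by rewrite ffunE eqxx.
  by apply/ffunP => k; rewrite !ffunE; case: eqP => [->|].
under eq_bigr do rewrite big_distrr /=.
rewrite mulr_sumr.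
under [RHS]eq_bigr do rewrite big_distrl /=.
rewrite !pair_big_dep /= (reindex_inj (can_inj hK)) /=.
apply: eq_big => [[d i]|[d i]] /=.
  apply/andP/andP => -[/eqP dS Gi]; last first.
    by rewrite group_users_redirect ?dS ?eqxx //; move: Sk; rewrite -dS inE.
  move: Sk; rewrite -{1}dS inE ffunE eqxx => Gi'; split=> //.
  apply/eqP; rewrite -dS; apply/setP => k; rewrite !inE ffunE.
  by case: eqP => // ->; rewrite Gi Gi'.
move=> _; rewrite mulrA dprob_redirect.
have -> : redirect k0 (redirect k0 d i) (d k0) = d.
  by have [] := hK (d, i).
by ring.
Qed.

(** Letting the demand of one user of [S] run over [G] covers all [n] files with a single cache, and
    each demand has weight at least [P / (2 n)]. As in the later bounds, conditional expectations
    stay multiplied by the probability of the event, which may vanish. *)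
Lemma single_user_bound (S : {set 'I_K}) : S != finset.set0 ->
  (\sum_(d | group_users d == S) dprob p d) * ((1 - M / n%:R) / 2 - del) <=
  \sum_(d | group_users d == S) dprob p d * ell d.
Proof.
move=> /set0Pn[k0 Sk0]; rewrite -(ler_pM2l group_prob_gt0) -(resample_user Sk0).
rewrite mulrC -mulrA mulr_suml; apply: ler_sum => d _.
apply: ler_wpM2l; first exact: dprob_ge0.
have nR : 1 <= n%:R :> R by rewrite ler1n.
have P0 := group_prob_gt0.
have cov : n%:R <= M + \sum_(i in G) ell (redirect k0 d i) + del.
  have := @cutset 'I_n (fun j => redirect k0 d (enum_val j)) [set k0]%SET G.
  rewrite finset.cards1 mul1r -(big_enum_val (fun i => ell (redirect k0 d i))).
  apply; first by rewrite card_ord (leq_trans (max_card _)) // card_ord; lia.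
  move=> i Gi; exists (enum_rank_in Gi i), k0; first by rewrite inE.
  by rewrite ffunE eqxx enum_rankK_in.
have : P / (2 * n%:R) * \sum_(i in G) ell (redirect k0 d i)
       <= \sum_(i in G) p i * ell (redirect k0 d i).
  rewrite mulr_sumr; apply: ler_sum => i Gi; apply: ler_wpM2r => //.
  exact: group_prob_le.
apply: le_trans.
have -> : ((1 - M / n%:R) / 2 - del) * P =
          P / (2 * n%:R) * (n%:R - M - 2 * n%:R * del) by field; rewrite gt_eqF //; lra.
apply: ler_wpM2l; first by rewrite divr_ge0 //; lra.
(* The cut-set loses [del] where the claim allows [2 * n * del]. *)
have del_le : 0 <= (n%:R - 1) * del by rewrite mulr_ge0 // subr_ge0.
have := del0; lra.
Qed.

(** * Independent demand vectors conditioned on the users of the group *)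

Definition avoids (A : {set 'I_K}) (i : 'I_N) (d : demand_t N K) :=
  [forall k in A, d k != i].

Lemma sum_dprob_group_users (S : {set 'I_K}) :
  \sum_(d | group_users d == S) dprob p d =
  \prod_k \sum_(i < N | (i \in G) == (k \in S)) p i.
Proof.
rewrite -sum_dprob_family; apply: eq_bigl => d; apply/eqP/forallP => [<- k|H].
  by rewrite inE.
by apply/setP => k; rewrite inE (eqP (H k)).
Qed.

(** Given [S], the demands stay independent, and each user of [A] misses [i] with probability at
    most [1 - 1 / (2 n)]. *)
Lemma avoid_prob_le (S A : {set 'I_K}) (i : 'I_N) : A \subset S -> i \in G ->
  \sum_(d | (group_users d == S) && avoids A i d) dprob p d <=
  (1 - (2 * n%:R)^-1) ^+ #|A| * \sum_(d | group_users d == S) dprob p d.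
Proof.
move=> /fintype.subsetP sAS Gi; rewrite sum_dprob_group_users.
rewrite (eq_bigl (fun d : demand_t N K => [forall k,
    ((d k \in G) == (k \in S)) && ((k \in A) ==> (d k != i))])); last first.
  move=> d; apply/andP/forallP => [[/eqP <- /forallP H] k|H].
    by rewrite H andbT inE.
  split; last by apply/forallP => k; have /andP[] := H k.
  by apply/eqP/setP => k; have /andP[/eqP <- _] := H k; rewrite inE.
rewrite (sum_dprob_family p (fun k j =>
    ((j \in G) == (k \in S)) && ((k \in A) ==> (j != i)))).
have -> : (1 - (2 * n%:R)^-1) ^+ #|A| =
    \prod_(k < K) (if k \in A then 1 - (2 * n%:R)^-1 else 1 : R).
  by rewrite -big_mkcond /= prodr_const.
rewrite -big_split /=; apply: ler_prod => k _.
apply/andP; split; first by apply: sumr_ge0 => j _; apply: ltW.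
have [Ak|nAk] /= := boolP (k \in A); last first.
  by rewrite mul1r; under eq_bigl do rewrite andbT.
rewrite sAS //; have nR : 1 <= n%:R :> R by rewrite ler1n.
have -> : \sum_(j < N | (j \in G) == true) p j = P by apply: eq_bigl => j; rewrite eqb_id.
have -> : \sum_(j < N | ((j \in G) == true) && (j != i)) p j = P - p i.
  rewrite [X in _ = X - _](bigD1 i) //= addrAC subrr add0r.
  by apply: eq_bigl => j; rewrite eqb_id.
have := group_prob_le Gi.
by rewrite mulrBl mul1r [_^-1 * _]mulrC lerD2l lerN2.
Qed.

(** Average the cut-set inequality over [t] independent demand vectors drawn given [S]: the expected
    number of files of [G] requested by [A] is at least [n] minus [n] times the bound on missing one
    file in [#|A| * t] requests. *)
Lemma iid_bound (S A : {set 'I_K}) (t : nat) :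
  A \subset S -> (0 < t <= T)%N ->
  (\sum_(d | group_users d == S) dprob p d) *
    ((n%:R * (1 - (1 - (2 * n%:R)^-1) ^+ (#|A| * t)) - #|A|%:R * M - del) / t%:R) <=
  \sum_(d | group_users d == S) dprob p d * ell d.
Proof.
move=> sAS /andP[t0 tT].
set W := \sum_(d | _) dprob p d; set E := \sum_(d | _) _ * ell d.
have W_ge0 : 0 <= W by apply: sumr_ge0 => d _; apply: dprob_ge0.
have E_ge0 : 0 <= E by apply: sumr_ge0 => d _; rewrite mulr_ge0 ?dprob_ge0.
have [W0|Wn0] := eqVneq W 0; first by rewrite W0 mul0r.
have W_gt0 : 0 < W by rewrite lt_def Wn0.
have nR : 1 <= n%:R :> R by rewrite ler1n.
have tR : 0 < t%:R :> R by rewrite ltr0n.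
pose C : pred (demand_t N K) := [pred d | group_users d == S].
(* Unnormalised product law on [t]-tuples, of total mass [W ^+ t]; [U D] collects the files of [G]
   requested by [A] in some [D j]. *)
pose w (D : {ffun 'I_t -> demand_t N K}) : R := \prod_j dprob p (D j).
pose U (D : {ffun 'I_t -> demand_t N K}) : {set 'I_N} :=
  [set i in G | ~~ [forall j, avoids A i (D j)]].
have sum_w : \sum_(D in ffun_on C) w D = W ^+ t.
  by rewrite -(bigA_distr_big C (fun _ d => dprob p d)) prodr_const card_ord.
have sum_ell : \sum_(D in ffun_on C) w D * \sum_j ell (D j) = t%:R * (W ^+ t.-1 * E).
  under eq_bigr do rewrite mulr_sumr.
  rewrite exchange_big /= (eq_bigr (fun _ => W ^+ t.-1 * E)); last first.
    move=> j _.
    (* Inserting [ell] in the factor [j] only makes the sum factorise into [E] and [t - 1] copies of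
       [W]. *)
    rewrite (eq_bigr (fun D : {ffun 'I_t -> demand_t N K} =>
      \prod_j' (dprob p (D j') * (if j' == j then ell (D j') else 1)))); last first.
      by move=> D _; rewrite big_split /= -big_mkcond big_pred1_eq.
    rewrite -(bigA_distr_big C
      (fun j' d => dprob p d * (if j' == j then ell d else 1))).
    rewrite (bigD1 j) //= mulrC eqxx; congr (_ * _).
    rewrite (eq_bigr (fun _ => W)); last first.
      by move=> j' /negPf ->; apply: eq_bigr => d _; rewrite mulr1.
    by rewrite prodr_const (eq_card (B := predC1 j)) // cardC1 card_ord.
  by rewrite sumr_const card_ord mulr_natl.
have cardU D : #|U D|%:R = n%:R - \sum_(i in G) ([forall j, avoids A i (D j)])%:R :> R.
  rewrite -sum1_card natr_sum -[n in RHS]sum1_card natr_sum -sumrB big_mkcond.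
  rewrite [RHS]big_mkcond /=; apply: eq_bigr => i _; rewrite inE.
  by case: (i \in G) => //=; case: [forall _, _]; rewrite ?subrr ?subr0.
have sum_U : W ^+ t * (n%:R * (1 - (1 - (2 * n%:R)^-1) ^+ (#|A| * t)))
             <= \sum_(D in ffun_on C) w D * #|U D|%:R.
  under eq_bigr do rewrite cardU mulrBr mulr_sumr.
  rewrite sumrB -mulr_suml sum_w exchange_big /= mulrA mulrBr mulr1 lerD2l lerN2.
  rewrite -mulrA mulrCA [X in _ <= X]mulr_natl -sumr_const.
  apply: ler_sum => i Gi.
  (* The event of missing [i] in all [t] vectors factorises over them, so [avoid_prob_le] applies to
     each factor. *)
  rewrite exprM -exprMn mulrC.
  rewrite (eq_bigr (fun D : {ffun 'I_t -> demand_t N K} =>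
      \prod_j (dprob p (D j) * (avoids A i (D j))%:R))); last first.
    move=> D _; rewrite big_split /=; congr (_ * _).
    have [/forallP H|] := boolP [forall j, avoids A i (D j)].
      by rewrite big1 // => j _; rewrite H.
    by rewrite negb_forall => /existsP[j /negPf H]; rewrite (bigD1 j) //= H mul0r.
  rewrite -(bigA_distr_big C (fun _ d => dprob p d * (avoids A i d)%:R)).
  rewrite prodr_const card_ord; apply: lerXn2r.
  - by rewrite nnegrE; apply: sumr_ge0 => d _; rewrite mulr_ge0 ?dprob_ge0.
  - rewrite nnegrE mulr_ge0 // exprn_ge0 // subr_ge0 invf_le1; lra.
  apply: le_trans (avoid_prob_le sAS Gi); rewrite big_mkcondr /=.
  by apply: ler_sum => d _; case: avoids; rewrite ?mulr1 ?mulr0.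
have key : \sum_(D in ffun_on C) w D * #|U D|%:R <=
    \sum_(D in ffun_on C) w D * (#|A|%:R * M + \sum_j ell (D j) + del).
  apply: ler_sum => D _; apply: ler_wpM2l.
    by apply: prodr_ge0 => j _; apply: dprob_ge0.
  apply: cutset; first by rewrite card_ord.
  move=> i; rewrite inE => /andP[Gi]; rewrite negb_forall => /existsP[j].
  rewrite negb_forall => /existsP[k]; rewrite negb_imply negbK => /andP[Ak /eqP].
  by exists j, k.
move: (le_trans sum_U key).
under [X in _ <= X -> _]eq_bigr do rewrite addrAC mulrDr.
rewrite big_split /= -mulr_suml sum_w sum_ell -[t in W ^+ t](prednK t0) exprSr.
have Wt : 0 < W ^+ t.-1 by rewrite exprn_gt0.
rewrite -!mulrA [t%:R * _]mulrCA -mulrDr ler_pM2l // => le.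
rewrite mulrA ler_pdivrMr //; lra.
Qed.

Lemma small_cache_bound (S : {set 'I_K}) : S != finset.set0 -> 4 * M <= n%:R ->
  (\sum_(d | group_users d == S) dprob p d) * (Rfn M n #|S| / 192 - del) <=
  \sum_(d | group_users d == S) dprob p d * ell d.
Proof.
rewrite -card_gt0 => S0 Mn.
(* The second condition keeps [s] caches within a quarter of the group; it holds for [s = 1] by
   assumption. *)
pose Q s := (s <= minn n #|S|)%N && (4 * s%:R * M <= n%:R).
have Q1 : Q 1%N by rewrite /Q leq_min n0 S0 mulr1.
have Qub s : Q s -> (s <= minn n #|S|)%N by case/andP.
case: (ex_maxnP (ex_intro _ 1%N Q1) Qub) => s /andP[] /[!leq_min] /andP[sn sS] sM smax.
have s1 := smax _ Q1.
(* Either [s] is the minimum itself, or [s + 1] violates the cache condition and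
   [n / M < 4 * (s + 1) <= 8 * s]. *)
have RS : Rfn M n #|S| <= 8 * s%:R.
  have [sle|sgt] := leqP (minn n #|S|) s.
    apply: le_trans (Rfn_le_min _ _ n0) _.
    by rewrite -natrM ler_nat (leq_trans sle) // leq_pmull.
  have : ~~ Q s.+1 by apply/negP => /smax; rewrite ltnn.
  rewrite /Q sgt /= -ltNge => ltn.
  have M_gt0 : 0 < M.
    by rewrite lt_def M0 andbT; apply: contraTneq ltn => ->; rewrite mulr0 -leNgt.
  have nR : 1 <= n%:R :> R by rewrite ler1n.
  apply: le_trans (Rfn_le_div _ M_gt0 n0 _) _; first by have := M0; lra.
  apply: (@le_trans _ _ (n%:R / M)).
    by apply: ler_piMl; rewrite ?divr_ge0 // gerBl divr_ge0.
  rewrite ler_pdivrMr //; apply: le_trans (ltW ltn) _.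
  apply: ler_wpM2r => //; rewrite -!natrM ler_nat; lia.
have [A sAS cA] := subset_of_card sS.
(* This choice gives [n <= s * t <= n + s <= 2 * n]. *)
pose t := (n %/ s).+1.
have stn : (n <= s * t)%N by rewrite mulnC ltnW // ltn_ceil.
have st2n : (s * t <= 2 * n)%N.
  by rewrite /t mulnS mul2n -addnn leq_add // mulnC leq_trunc_div.
have nN : (n <= N)%N by rewrite (leq_trans (max_card _)) // card_ord.
have tT : (0 < t <= T)%N.
  rewrite /=; apply: leq_trans NT; apply: (@leq_trans (2 * n)); last by rewrite leq_mul2l.
  by apply: leq_trans st2n; rewrite leq_pmull.
apply: le_trans (iid_bound sAS tT); apply: ler_wpM2l.
  by apply: sumr_ge0 => d _; apply: dprob_ge0.
rewrite cA.
have nR : 1 <= n%:R :> R by rewrite ler1n.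
have tR : 1 <= t%:R :> R by rewrite ler1n.
have sR : 1 <= s%:R :> R by rewrite ler1n.
have stnR : n%:R <= s%:R * t%:R :> R by rewrite -natrM ler_nat.
have st2nR : s%:R * t%:R <= 2 * n%:R :> R by rewrite -!natrM ler_nat.
have y01 : 0 <= (2 * n%:R : R)^-1 <= 1.
  by apply/andP; split; [rewrite invr_ge0|rewrite invf_le1]; lra.
have := expr_1sub_le (s * t) y01; set q := (1 - _) ^+ _ => qle.
(* Since [s * t / (2 n) >= 1/2], the bound [qle] gives [q * (3/2) <= 1]. *)
have q23 : q <= 2 / 3.
  have q0 : 0 <= q.
    by rewrite exprn_ge0 // subr_ge0; case/andP: y01.
  have : 2^-1 <= (s * t)%:R * (2 * n%:R)^-1 :> R.
    rewrite ler_pdivlMr; last by lra.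
    by rewrite natrM; lra.
  by move: qle q0; clearbody q; move: (_ * (2 * _)^-1) => z; nra.
rewrite ler_pdivlMr; last by lra.
have nq : n%:R * q <= n%:R * (2 / 3) by rewrite ler_wpM2l.
have Rt : Rfn M n #|S| * t%:R <= 8 * s%:R * t%:R by rewrite ler_wpM2r.
have delt : 0 <= del * (t%:R - 1) by rewrite mulr_ge0 // subr_ge0.
(* The excess is [n/3 - n/4 = n/12]; dividing by [t <= 2 * n / s] leaves [s / 24 >= Rfn / 192], as
   [Rfn <= 8 * s]. *)
lra.
Qed.

Lemma conditional_bound (S : {set 'I_K}) :
  (\sum_(d | group_users d == S) dprob p d) * (Rfn M n #|S| / 192 - del) <=
  \sum_(d | group_users d == S) dprob p d * ell d.
Proof.
have W0 : 0 <= \sum_(d | group_users d == S) dprob p d.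
  by apply: sumr_ge0 => d _; apply: dprob_ge0.
have trivial : Rfn M n #|S| <= 0 ->
  (\sum_(d | group_users d == S) dprob p d) * (Rfn M n #|S| / 192 - del) <=
  \sum_(d | group_users d == S) dprob p d * ell d.
  move=> R0; apply: (@le_trans _ _ 0).
    by apply: mulr_ge0_le0 => //; have := del0; lra.
  by apply: sumr_ge0 => d _; rewrite mulr_ge0 ?dprob_ge0.
have [S0|S0] := eqVneq S finset.set0.
  apply: trivial; apply: le_trans (Rfn_le_min _ _ n0) _.
  by rewrite S0 finset.cards0 minn0.
have [Mn|Mn] := leP (4 * M) n%:R; first exact: small_cache_bound.
have [nM|nM] := ltP n%:R M; first by apply: trivial; rewrite Rfn_gt_eq0.
have nR : 1 <= n%:R :> R by rewrite ler1n.
have M_gt0 : 0 < M by lra.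
apply: le_trans (single_user_bound S0); apply: ler_wpM2l => //.
have := Rfn_le_div #|S| M_gt0 n0 nM.
have a0 : 0 <= 1 - M / n%:R by rewrite subr_ge0 ler_pdivrMr ?mul1r // ltr0n.
(* For [n / 4 < M <= n] this yields [Rfn <= 4 * (1 - M / n)], so one user already gives
   [Rfn / 8]. *)
have : n%:R / M <= 4 by rewrite ler_pdivrMr // ltW.
move: (1 - M / n%:R) a0 (n%:R / M) => a a0 x x4 le.
have : a * x <= a * 4 by rewrite ler_wpM2l.
lra.
Qed.

Lemma group_bound : \sum_(i < N) p i = 1 ->
  \sum_d dprob p d * Rfn M n #|group_users d| <=
  192 * (\sum_d dprob p d * ell d + del).
Proof.
move=> p1.
have : \sum_d dprob p d * (Rfn M n #|group_users d| / 192 - del)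
       <= \sum_d dprob p d * ell d.
  rewrite (partition_big group_users predT) //=.
  rewrite [X in _ <= X](partition_big group_users predT) //=.
  apply: ler_sum => S _; apply: le_trans (conditional_bound S).
  by rewrite mulr_suml; apply: ler_sum => d /eqP ->.
under eq_bigr do rewrite mulrBr mulrA.
rewrite sumrB -!mulr_suml sum_dprob // mul1r; lra.
Qed.

End Group.

(** * From finite blocklength to achievable rates *)

Lemma achievable_group_bound (R : realType) (N K : nat) (M : R) (p : nat -> R)
    (G : {set 'I_N}) (r : R) :
  0 <= M -> (forall i : 'I_N, 0 < p i) -> \sum_(i < N) p i = 1 ->
  (0 < #|G|)%N ->
  (forall i, i \in G -> \sum_(j in G) p j <= 2 * #|G|%:R * p i) ->
  achievable N K M p r ->
  \sum_(d : demand_t N K) dprob p d * Rfn M #|G| #|group_users G d| <= 192 * r.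
Proof.
move=> M0 p0 p1 G0 nearG achr; apply/ler_addgt0Pl => e e0.
have NR : 1 <= N%:R :> R.
  by rewrite ler1n (leq_trans G0) // (leq_trans (max_card _)) // card_ord.
(* The total loss is [192 * (eps + 1 / F)] with [1 / F <= eps], hence [384]; the other term makes
   the union bound over [2 * N] demand vectors at most [1/2]. *)
pose eps := Num.min (e / 384) (4 * N%:R)^-1.
have eps0 : 0 < eps.
  by rewrite lt_min divr_gt0 //= invr_gt0; lra.
have [F0 sch] := achr eps eps0.
pose F := maxn F0 (Num.truncn (eps^-1)).+1.
have F_gt0 : (0 < F)%N by rewrite leq_max orbT.
have Feps : F%:R^-1 <= eps.
  rewrite -[eps]invrK lef_pV2 ?posrE ?invr_gt0 ?ltr0n //.
  apply: le_trans (ltW (truncnS_gt _)) _.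
  by rewrite ler_nat leq_max leqnn orbT.
have Teps : (2 * N)%:R * eps <= 2^-1.
  apply: (@le_trans _ _ ((2 * N)%:R * (4 * N%:R)^-1)).
    by rewrite ler_wpM2l ?ler0n // ge_min lexx orbT.
  by rewrite natrM invfM mulrACA divff ?gt_eqF // ?mulr1; lra.
have [ell [ell0 cut rate]] :=
  scheme_cutset_bound F_gt0 eps0 Teps (sch F (leq_maxl _ _) F_gt0).
have Finv : 0 <= F%:R^-1 :> R by rewrite invr_ge0 ler0n.
have := group_bound M0 p0 ell0 Finv cut (leqnn _) G0 nearG p1.
have : eps <= e / 384 by rewrite ge_min lexx.
lra.
Qed.

(** Sending all files without caching shows that some rate is achievable, so that the infimum
    [Rstar] is taken over a nonempty set. *)
Lemma scheme_send_everything (R : realType) (N K F : nat) (M : R) (p : nat -> R)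
    (eps : R) :
  0 <= M -> \sum_(n < N) p n = 1 -> 0 < eps -> (0 < F)%N ->
  scheme_exists N K F M p eps N%:R.
Proof.
move=> M0 p1 eps0 F0.
have cardE : #|{: files_t N F}| = (2 ^ (F * N))%N := card_files N F.
exists 0%N, (fun _ _ => ord0), (fun _ => (F * N)%N).
exists (fun _ w => cast_ord cardE (enum_rank w)).
exists (fun d k x _ => (enum_val (cast_ord (esym cardE) x) : files_t N F) (d k)).
split=> [|d|]; first by rewrite mulr_ge0.
  apply: (@le_trans _ _ 0); last by rewrite mulr_ge0 // ltW.
  rewrite lern0 cards_eq0; apply/eqP/setP => w; rewrite !inE.
  apply/negbTE; rewrite negb_exists.
  by apply/forallP => k; rewrite cast_ordK enum_rankK negbK.
rewrite -mulr_suml sum_dprob // mul1r natrM mulrC mulKf; last first.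
  by rewrite pnatr_eq0 -lt0n.
by rewrite lerDl ltW.
Qed.

(** * Averaging over the popularity groups *)

Lemma card_ord_interval (N a c : nat) : (c <= N)%N ->
  #|[set i : 'I_N | (a <= i < c)%N]%SET| = (c - a)%N.
Proof.
move=> cN; rewrite -sum1_card.
under eq_bigl do rewrite inE.
rewrite -(big_mkord (fun i => (a <= i < c)%N) (fun => 1%N)).
rewrite -[RHS]muln1 -sum_nat_const_nat [RHS](big_nat_widenl _ 0) //.
rewrite [RHS](big_nat_widen _ _ _ _ _ cN) /=.
by apply: eq_bigl => i.
Qed.

Theorem theorem2 (R : realType) :
  exists c : R, 0 < c /\
  forall (N K : nat) (M : R) (p : nat -> R) (L : nat) (b : nat -> nat),
    (0 < N)%N -> 0 <= M ->
    \sum_(n < N) p n = 1 ->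
    (forall n : nat, (n.+1 < N)%N -> p n.+1 <= p n) ->
    0 < p N.-1 ->
    is_max_partition N p L b ->
    (c * L%:R)^-1 *
      \sum_(l < L) \sum_(d : demand_t N K)
         dprob p d * Rfn M (b l.+1 - b l) (users_in b l d)
    <= Rstar N K M p.
Proof.
exists 192; split=> // N K M p L b N0 M0 p1 pmono pN [b0 bL step].
have L0 : (0 < L)%N by rewrite lt0n; apply: contraTneq N0 => L0; rewrite -bL L0 b0.
have p_le i j : (i <= j < N)%N -> p j <= p i.
  elim: j => [|j IHj]; first by rewrite leqn0 => /andP[/eqP ->].
  rewrite leq_eqVlt => /andP[/orP[/eqP -> //|ij] jN].
  by apply: le_trans (pmono _ jN) (IHj _); rewrite -ltnS ij ltnW.
have p_gt0 (i : 'I_N) : 0 < p i.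
  by apply: lt_le_trans pN (p_le _ _ _); have := ltn_ord i; lia.
have b_le l : (l <= L)%N -> (b l <= N)%N.
  move=> lL; rewrite -bL; elim: L lL {L0 bL} step => [|L' IHL].
    by rewrite leqn0 => /eqP ->.
  rewrite leq_eqVlt => /orP[/eqP -> //|lL] step.
  have [lt _ _] := step L' (ltnSn _).
  by apply: leq_trans (ltnW lt); apply: IHL => // l' l'L; apply: step; rewrite ltnS ltnW.
apply: lb_le_inf.
  exists N%:R => eps eps0; exists 0%N => F _ F0.
  exact: scheme_send_everything.
move=> r achr; rewrite mulrC ler_pdivrMr ?mulr_gt0 ?ltr0n //.
(* Each of the [L] groups separately contributes at most [192 * r], whence the factor [L]. *)
apply: (@le_trans _ _ (\sum_(l < L) 192 * r)); last first.
  by rewrite sumr_const card_ord -mulr_natr; lra.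
apply: ler_sum => l _.
have [lt half _] := step l (ltn_ord l).
pose G : {set 'I_N} := [set i : 'I_N | (b l <= i < b l.+1)%N]%SET.
have cG : #|G| = (b l.+1 - b l)%N by apply/card_ord_interval/b_le.
have users_inE (d : demand_t N K) : users_in b l d = #|group_users G d|.
  by apply: eq_card => k; rewrite !inE.
under eq_bigr do rewrite users_inE -cG.
apply: achievable_group_bound => //; first by rewrite cG subn_gt0.
move=> i; rewrite inE => /andP[bi ib].
have bN := b_le _ (ltn_ord l).
(* Within the group, popularities lie between the last one and the first, which is at most twice the
   last. *)
apply: (@le_trans _ _ (\sum_(j in G) p (b l))).
  apply: ler_sum => j; rewrite inE => /andP[bj _].
  by apply: p_le; rewrite bj ltn_ord.
rewrite sumr_const -[X in X <= _]mulr_natl [2 * _]mulrC -mulrA; apply: ler_wpM2l => //.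
have : p (b l.+1).-1 <= p i by apply: p_le; lia.
lra.
Qed.
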